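(* Let $k>1$ and let $\{p_n\}_{n\ge 0}$ be a sequence of positive real numbers. Then $|C,1|_k\Leftrightarrow|\overline{N},p_n|_k$ (a series is summable $|C,1|_k$ if and only if it is summable $|\overline{N},p_n|_k$) if and only if both of the following hold: (i) $$\frac{np_n}{P_n}=O(1)\qquad(n\ge 1),$$ and (ii) $$\frac{P_n}{np_n}=O(1)\qquad(n\ge 1).$$
   Context: For a positive sequence $\{p_n\}_{n\ge0}$ put $P_n=\sum_{i=0}^n p_i$. Given a series $\sum_{n\ge 0} a_n$ with partial sums $s_n=\sum_{i=0}^n a_i$, the $n$th term of its $(\overline{N},p_n)$ (weighted mean) transform is $T_n=\frac1{P_n}\sum_{i=0}^n p_i s_i$. For $k>1$, the series $\sum a_n$ is called summable $|\overline{N},p_n|_k$ if $\sum_{n=1}^\infty n^{k-1}|\Delta T_n|^k<\infty$, where $\Delta T_n=T_n-T_{n-1}$. Summability $|C,1|_k$ (Cesàro of order 1) is the special case $p_n=1$ for all $n$, i.e. with $T_n=\frac1{n+1}\sum_{i=0}^n s_i$. The notation $A\Leftrightarrow B$ between summability methods means that exactly the same series are summable $A$ and summable $B$. The $O(1)$ bounds are with constants uniform in $n$. *)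

(* Defs.v *)
From HB Require Import structures.
From mathcomp Require Import all_boot all_order all_algebra.
From mathcomp Require Import all_classical all_reals all_analysis.

Set Implicit Arguments.
Unset Strict Implicit.
Unset Printing Implicit Defensive.

Import Order.TTheory GRing.Theory Num.Theory.
Import numFieldNormedType.Exports.

Local Open Scope ring_scope.

(* Partial sums are inclusive, u 0 + ... + u n; the library's [series u n]
   would stop at u (n - 1). *)
Definition psum (R : realType) (u : nat -> R) (n : nat) : R :=
  \sum_(0 <= i < n.+1) u i.

Definition wmean (R : realType) (p a : nat -> R) (n : nat) : R :=
  (psum p n)^-1 * \sum_(0 <= i < n.+1) p i * psum a i.

(* [n.-1] is only used for n >= 1, where it is the true predecessor. *)
Definition bdiff (R : realType) (t : nat -> R) (n : nat) : R := t n - t n.-1.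

(* The sum is taken in the extended reals, where a series of nonnegative terms
   always has a value. *)
Definition wmean_summable (R : realType) (p : nat -> R) (k : R)
    (a : nat -> R) : Prop :=
  (\sum_(1 <= n <oo)
     (n%:R `^ (k - 1) * `|bdiff (wmean p a) n| `^ k)%:E < +oo)%E.

Definition cesaro1_summable (R : realType) (k : R) (a : nat -> R) : Prop :=
  wmean_summable (fun=> 1) k a.

Definition same_summable (R : realType) (A B : (nat -> R) -> Prop) : Prop :=
  forall a : nat -> R, A a <-> B a.

(* u_n = O(1) for n >= 1, with one constant for all n. *)
Definition bigO1 (R : realType) (u : nat -> R) : Prop :=
  exists M : R, forall n : nat, (1 <= n)%N -> `|u n| <= M.

(* Main.v *)
Require Import Defs.
From HB Require Import structures.
From mathcomp Require Import all_boot all_order all_algebra.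
From mathcomp Require Import all_classical all_reals all_analysis.
From mathcomp Require Import ring lra.

Set Implicit Arguments.
Unset Strict Implicit.
Unset Printing Implicit Defensive.

Import Order.TTheory GRing.Theory Num.Theory.
Import numFieldNormedType.Exports.

Local Open Scope ring_scope.

(** Let q be a second positive weight with partial sums Q, and put
X_n = bdiff (wmean q a) n and Y_n = bdiff (wmean p a) n. The passage from X to
Y is lower triangular ([wmean_transform]):

  Y_n = (p_n Q_n / (P_n q_n)) X_n
        + p_n / (P_n P_{n-1}) * sum_{1 <= v < n} (P_v - p_v Q_v / q_v) X_v,

and X ranges over all sequences as a does ([wmean_bdiff_surj]). Taking q = 1
and then exchanging p and q gives both implications between the two methods,
so each half of the proof is stated for a pair of weights.

Sufficiency ([wmean_summable_sub]). If p_n/P_n and q_n/Q_n are both comparable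
to 1/n, the diagonal coefficient is bounded and P_v - p_v Q_v / q_v = O(P_v).
The second term is then at most a constant times p_n/P_n times the p-weighted
mean of z_v = (P_v/p_v) |X_v|. A Hardy inequality for weighted means
([weighted_hardy], which is Jensen plus a telescoping sum) bounds
sum p_n/P_n (mean of z)^k by sum p_n/P_n z_n^k = sum (P_n/p_n)^(k-1) |X_n|^k,
and comparability to n turns these weights into n^(k-1).

Necessity ([wmean_diag_bounded]). Write d_n = p_n Q_n / (P_n q_n) for the
diagonal. Since the matrix is triangular, the sign of X_n can be chosen after
X_1, ..., X_{n-1} so that the two terms of Y_n agree in sign
([signed_choice]), whence |Y_n| >= d_n |X_n| with |X_n| still arbitrary.
Hence multiplication by d_n^k preserves summability of nonnegative series,
which forces d_n to be bounded by an argument in the style of Abel and Dini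
([abel_dini]). For q = 1 this says that (n+1) p_n / P_n is bounded; with the
roles exchanged, that P_n / ((n+1) p_n) is. *)

(** * Partial sums and summability *)

Lemma psum0 (R : realType) (u : nat -> R) : psum u 0 = u 0.
Proof. by rewrite /psum big_nat1. Qed.

Lemma psumS (R : realType) (u : nat -> R) n : psum u n.+1 = psum u n + u n.+1.
Proof. by rewrite /psum big_nat_recr. Qed.

Lemma psum_gt0 (R : realType) (u : nat -> R) :
  (forall n, 0 < u n) -> forall n, 0 < psum u n.
Proof.
move=> u0; elim=> [|n IH]; first by rewrite psum0.
by rewrite psumS addr_gt0.
Qed.

Lemma psum_ge0 (R : realType) (u : nat -> R) :
  (forall n, 0 <= u n) -> forall n, 0 <= psum u n.
Proof. by move=> u0 n; apply: sumr_ge0. Qed.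

(** The index is shifted to start at 0, here and below, so that the predecessor
in [bdiff] is a true one. *)
Lemma wmean_summableP (R : realType) (p : nat -> R) (k : R) (a : nat -> R) :
  wmean_summable p k a <->
  exists M, forall N, \sum_(0 <= n < N)
    (n.+1%:R `^ (k - 1) * `|bdiff (wmean p a) n.+1| `^ k) <= M.
Proof.
rewrite /wmean_summable.
set f := fun n : nat => n%:R `^ (k - 1) * `|bdiff (wmean p a) n| `^ k.
have f0 n : 0 <= f n by rewrite mulr_ge0// powR_ge0.
have shift N : \sum_(0 <= n < N) f n.+1 = \sum_(1 <= n < N.+1) f n.
  by rewrite big_add1.
have fE N : (\sum_(1 <= n < N) (f n)%:E)%E = (\sum_(1 <= n < N) f n)%:E.
  by rewrite sumEFin.
split=> [fin|[M fM]].
  set s := (X in (X < _)%E) in fin.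
  have s0 : (0 <= s)%E by apply: nneseries_ge0 => n _ _; rewrite lee_fin.
  exists (fine s) => N; rewrite shift -lee_fin fineK ?ge0_fin_numE// -fE.
  by apply: nneseries_lim_ge => n _ _; rewrite lee_fin.
apply: (@le_lt_trans _ _ M%:E); last exact: ltry.
apply: lime_le; first by apply: is_cvg_nneseries => n _ _; rewrite lee_fin.
apply: nearW => -[|N]; rewrite fE lee_fin.
  by rewrite big_geq//; have := fM 0; rewrite big_geq.
by rewrite -shift.
Qed.

(** * Passing from one weighted mean to another *)

(** After clearing denominators, the difference is
p_{n+1} (P_n s_{n+1} - sum_{i <= n} p_i s_i), and the bracket grows by
P_{n+1} a_{n+2} from n to n+1. *)
Lemma bdiff_wmean (R : realType) (p a : nat -> R) (p0 : forall n, 0 < p n) n :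
  bdiff (wmean p a) n.+1 = p n.+1 / (psum p n.+1 * psum p n) *
    psum (fun i => psum p i * a i.+1) n.
Proof.
have P0 := psum_gt0 p0.
have key : psum (fun i => psum p i * a i.+1) n =
    psum p n * psum a n.+1 - psum (fun i => p i * psum a i) n.
  elim: n => [|n IH]; first by rewrite !psumS !psum0; ring.
  by rewrite [LHS]psumS IH !psumS; ring.
rewrite key /bdiff /wmean -!/(psum (fun i => p i * psum a i) _).
have := P0 n.+1; have := P0 n; rewrite !psumS => h1 h2.
by field; rewrite !gt_eqF.
Qed.

(** By [bdiff_wmean] both sides concern sums of P_i a_{i+1} and Q_i a_{i+1}.
Abel summation of P_i a_{i+1} = (P_i / Q_i) (Q_i a_{i+1}) gives the formula,
because P_{v+1} Q_v - P_v Q_{v+1} = q_{v+1} P_{v+1} - p_{v+1} Q_{v+1}. *)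
Lemma wmean_transform (R : realType) (p q a : nat -> R)
    (p0 : forall n, 0 < p n) (q0 : forall n, 0 < q n) n :
  bdiff (wmean p a) n.+1 =
    p n.+1 / psum p n.+1 * (psum q n.+1 / q n.+1) * bdiff (wmean q a) n.+1 +
    p n.+1 / (psum p n.+1 * psum p n) * \sum_(0 <= i < n)
      (psum p i.+1 - p i.+1 * (psum q i.+1 / q i.+1)) *
      bdiff (wmean q a) i.+1.
Proof.
have P0 := psum_gt0 p0; have Q0 := psum_gt0 q0.
set S := (\sum_(0 <= i < n) _).
suff key : psum (fun i => psum p i * a i.+1) n =
    psum p n / psum q n * psum (fun i => psum q i * a i.+1) n + S.
  rewrite !bdiff_wmean// key mulrDr; congr (_ + _).
  by field; rewrite !gt_eqF.
rewrite {}/S; elim: n => [|n IH].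
  by rewrite big_geq// !psum0 addr0; field; rewrite gt_eqF.
rewrite big_nat_recr//= [LHS]psumS IH [psum (fun i => psum q i * _) _.+1]psumS.
rewrite bdiff_wmean//; move: (\sum_(_ <= _ < _) _) => S.
move: (psum (fun i => psum q i * _) n) => V.
have := P0 n.+1; have := Q0 n.+1; rewrite !psumS => h1 h2.
by field; rewrite !gt_eqF.
Qed.

(** Solve [bdiff_wmean] for a: [v n] below is the value that
sum_{i <= n} Q_i a_{i+1} must take, and its increments determine a. *)
Lemma wmean_bdiff_surj (R : realType) (q X : nat -> R)
    (q0 : forall n, 0 < q n) :
  exists a, forall n, bdiff (wmean q a) n.+1 = X n.
Proof.
have Q0 := psum_gt0 q0.
pose v n := psum q n.+1 * psum q n / q n.+1 * X n.
pose a n := if n is i.+1 then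
  (v i - (if i is j.+1 then v j else 0)) / psum q i else 0.
exists a => n; rewrite bdiff_wmean//.
have -> : psum (fun i => psum q i * a i.+1) n = v n; last first.
  by rewrite /v; field; rewrite !gt_eqF.
elim: n => [|n IH]; first by rewrite psum0 /= subr0 mulrC divfK// gt_eqF.
by rewrite psumS IH /= mulrC divfK ?gt_eqF// subrKC.
Qed.

(** * A Hardy inequality for weighted means *)

(** Convexity of the power, with unnormalised weights so that partial sums of p
can serve as weights. *)
Lemma powR_wavg (R : realType) (k s t x y : R) : 1 <= k ->
  0 < s -> 0 < t -> 0 <= x -> 0 <= y ->
  ((s * x + t * y) / (s + t)) `^ k <= (s * x `^ k + t * y `^ k) / (s + t).
Proof.
move=> k1 s0 t0 x0 y0; have st0 : 0 < s + t by rewrite addr_gt0.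
have h0 : 0 <= s / (s + t) by rewrite divr_ge0// ltW.
have h1 : s / (s + t) <= 1 by rewrite ler_pdivrMr// mul1r lerDl ltW.
have := @convex_powR R k k1 (Itv01 h0 h1) x y.
rewrite !inE/= !in_itv/= !andbT => /(_ x0 y0) cvx.
rewrite convRE [X in X `^ _ <= _]convRE /= in cvx; move: cvx.
have -> : unstable.onem (s / (s + t)) = t / (s + t).
  by rewrite /unstable.onem; field; rewrite gt_eqF.
have e u w : s / (s + t) * u + t / (s + t) * w = (s * u + t * w) / (s + t).
  by field; rewrite gt_eqF.
by rewrite !e.
Qed.

Lemma powRD_le (R : realType) (k x y : R) : 1 <= k -> 0 <= x -> 0 <= y ->
  (x + y) `^ k <= 2 `^ k * (x `^ k + y `^ k).
Proof.
move=> k1 x0 y0; have := powR_wavg k1 ltr01 ltr01 x0 y0.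
rewrite !mul1r => h.
have -> : x + y = 2 * ((x + y) / (1 + 1)) by field.
rewrite powRM ?divr_ge0 ?addr_ge0// ler_wpM2l ?powR_ge0//.
apply: (le_trans h); rewrite ler_pdivrMr//.
have := powR_ge0 x k; have := powR_ge0 y k; lra.
Qed.

(** The mean up to n+1 is a two-point average of the mean up to n and of
z_{n+1}, with weights P_n and p_{n+1}, so convexity iterates. *)
Lemma jensen_psum (R : realType) (p z : nat -> R) (k : R)
    (p0 : forall n, 0 < p n) (z0 : forall n, 0 <= z n) (k1 : 1 <= k) n :
  (psum (fun i => p i * z i) n / psum p n) `^ k <=
  psum (fun i => p i * z i `^ k) n / psum p n.
Proof.
have P0 := psum_gt0 p0.
elim: n => [|n IH].
  by rewrite !psum0 !(mulrC (p 0)) !mulfK// gt_eqF.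
have A0 : 0 <= psum (fun i => p i * z i) n / psum p n.
  apply: divr_ge0; last exact: ltW.
  by apply: psum_ge0 => i; rewrite mulr_ge0// ltW.
have := powR_wavg k1 (P0 n) (p0 n.+1) A0 (z0 n.+1).
rewrite (mulrC (psum p n)) divfK ?gt_eqF// -(psumS p) => h.
rewrite (psumS (fun i => p i * z i)); apply: le_trans h _.
rewrite ler_wpM2r ?invr_ge0 ?(ltW (P0 _))// psumS lerD2r.
by rewrite mulrC -ler_pdivlMr.
Qed.

(** By Jensen the n-th term is at most W_n (1/P_n - 1/P_{n+1}), where
W_n = sum_{i <= n} p_i z_i^k; summation by parts collapses the total. The
boundary term W_N / P_N has to be kept on the left for the induction. *)
Lemma weighted_hardy (R : realType) (p z : nat -> R) (k : R)
    (p0 : forall n, 0 < p n) (z0 : forall n, 0 <= z n) (k1 : 1 <= k) N :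
  \sum_(0 <= n < N) p n.+1 / psum p n.+1 *
    (psum (fun i => p i * z i) n / psum p n) `^ k <=
  psum (fun n => p n / psum p n * z n `^ k) N.
Proof.
have P0 := psum_gt0 p0.
pose W := psum (fun i => p i * z i `^ k).
have W0 n : 0 <= W n by apply: psum_ge0 => i; rewrite mulr_ge0 ?powR_ge0// ltW.
suff : \sum_(0 <= n < N) p n.+1 / psum p n.+1 *
    (psum (fun i => p i * z i) n / psum p n) `^ k + W N / psum p N <=
    psum (fun n => p n / psum p n * z n `^ k) N.
  by apply: le_trans; rewrite lerDl divr_ge0// ltW.
elim: N => [|N IH].
  by rewrite big_geq// /W !psum0 add0r mulrAC.
have WS : W N.+1 = W N + p N.+1 * z N.+1 `^ k by rewrite /W psumS.
rewrite big_nat_recr//= (psumS (fun n => p n / psum p n * z n `^ k)) WS.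
have := jensen_psum p0 z0 k1 N; rewrite -/(W N).
move: IH; set A := \sum_(_ <= _ < _) _; set B := psum (fun n => _ * _) N.
set J := (_ / _) `^ k => IH hJ.
have hJ' : p N.+1 / psum p N.+1 * J <= p N.+1 / psum p N.+1 * (W N / psum p N).
  by rewrite ler_wpM2l// divr_ge0 ?ltW.
have e : p N.+1 / psum p N.+1 * (W N / psum p N) +
    (W N + p N.+1 * z N.+1 `^ k) / psum p N.+1 =
    W N / psum p N + p N.+1 / psum p N.+1 * z N.+1 `^ k.
  have := P0 N.+1; rewrite psumS => h; field; by rewrite !gt_eqF.
lra.
Qed.

(** * Sufficiency *)

(** The two O(1) conditions with one constant and without division, in a form
that the constant weight 1 also satisfies. *)
Definition comparable_to_index (R : realType) (p : nat -> R) (C : R) :=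
  forall n, n.+1%:R * p n.+1 <= C * psum p n.+1 /\
            psum p n.+1 <= C * (n.+1%:R * p n.+1).

(** Both the diagonal and the off-diagonal part of [wmean_transform] are
bounded on the space with weights n^(k-1): the former because its coefficients
are, the latter by [weighted_hardy]. *)
Lemma wmean_summable_sub (R : realType) (k C : R) (p q : nat -> R) :
  1 < k -> (forall n, 0 < p n) -> (forall n, 0 < q n) ->
  comparable_to_index p C -> comparable_to_index q C ->
  forall a, wmean_summable q k a -> wmean_summable p k a.
Proof.
move=> hk p0 q0 hp hq a.
have P0 := psum_gt0 p0; have Q0 := psum_gt0 q0.
have k1 : 1 <= k := ltW hk.
have k0 : 0 <= k := le_trans ler01 k1.
have k10 : 0 <= k - 1 by rewrite subr_ge0.
have n0 n : 0 < n.+1%:R :> R by rewrite ltr0n.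
have n00 n : 0 <= n.+1%:R :> R by exact: ltW.
have p00 n : 0 <= p n by exact: ltW.
have P00 n : 0 <= psum p n by exact: ltW.
have Q00 n : 0 <= psum q n by exact: ltW.
have C0 : 0 <= C.
  rewrite -(pmulr_lge0 _ (P0 1%N)).
  by apply: le_trans (hp 0).1; rewrite mulr_ge0//.
have pP n : 0 <= p n / psum p n by rewrite divr_ge0//.
have pPC n : n.+1%:R * (p n.+1 / psum p n.+1) <= C.
  by rewrite mulrA ler_pdivrMr// (hp n).1.
have Pp n : psum p n.+1 / p n.+1 <= C * n.+1%:R.
  by rewrite ler_pdivrMr// -mulrA (hp n).2.
have Qq n : psum q n.+1 / q n.+1 <= C * n.+1%:R.
  by rewrite ler_pdivrMr// -mulrA (hq n).2.
have Qq0 n : 0 <= psum q n / q n by rewrite divr_ge0// ltW.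
rewrite !wmean_summableP => -[M hM].
pose X n := bdiff (wmean q a) n.+1.
(* [z] is set to 0 at index 0 because X starts at index 1; then p_i z_i is
   exactly the weight P_i |X_i| of the off-diagonal sum. *)
pose z n := if n is i.+1 then psum p i.+1 / p i.+1 * `|X i| else 0.
have z0 n : 0 <= z n.
  by case: n => //= n; rewrite mulr_ge0// divr_ge0//.
pose H n := psum (fun i => p i * z i) n / psum p n.
have pz0 n : 0 <= psum (fun i => p i * z i) n.
  by apply: psum_ge0 => i; rewrite mulr_ge0//.
have H0 n : 0 <= H n by rewrite /H divr_ge0//.
have HE n : psum (fun i => p i * z i) n =
    \sum_(0 <= i < n) psum p i.+1 * `|X i|.
  rewrite /psum big_nat_recl//= mulr0 add0r; apply: eq_bigr => i _.
  by rewrite -/(psum p i.+1) mulrA mulrCA divff ?gt_eqF// mulr1.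
(* [D] bounds the diagonal by C * C and |P_v - p_v Q_v / q_v| / P_v by
   1 + C * C. *)
pose D := 1 + C * C.
have D0 : 0 <= D by rewrite addr_ge0// mulr_ge0.
have coefD n : p n.+1 * (psum q n.+1 / q n.+1) <= C * C * psum p n.+1.
  apply: (@le_trans _ _ (p n.+1 * (C * n.+1%:R))).
    by rewrite ler_wpM2l// Qq.
  by rewrite mulrCA (mulrC (p _)) -mulrA ler_wpM2l// (hp n).1.
have YD n : `|bdiff (wmean p a) n.+1| <=
    D * (`|X n| + p n.+1 / psum p n.+1 * H n).
  rewrite (wmean_transform a p0 q0) [leRHS]mulrDr -/(X n).
  apply: le_trans (ler_normD _ _) _; apply: lerD.
    rewrite normrM ler_wpM2r// ger0_norm; last exact: mulr_ge0.
    rewrite mulrAC ler_pdivrMr//; apply: (le_trans (coefD n)).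
    by rewrite ler_wpM2r// lerDr.
  rewrite normrM ger0_norm; last by rewrite divr_ge0// mulr_ge0.
  rewrite /H HE.
  rewrite [leRHS](_ : _ = p n.+1 / (psum p n.+1 * psum p n) *
    (D * \sum_(0 <= i < n) psum p i.+1 * `|X i|)); last first.
    by field; rewrite !gt_eqF.
  rewrite ler_wpM2l//; first by rewrite divr_ge0// mulr_ge0.
  apply: le_trans (ler_norm_sum _ _ _) _; rewrite mulr_sumr.
  apply: ler_sum => i _; rewrite normrM [leRHS]mulrA ler_wpM2r//.
  apply: le_trans (ler_normB _ _) _; rewrite ger0_norm//.
  rewrite ger0_norm; last exact: mulr_ge0.
  by rewrite mulrDl mul1r lerD2l coefD.
pose E := C `^ (k - 1).
have E0 : 0 <= E by exact: powR_ge0.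
pose x n := n.+1%:R `^ (k - 1) * `|X n| `^ k.
pose h n := p n.+1 / psum p n.+1 * H n `^ k.
have step n : n.+1%:R `^ (k - 1) * `|bdiff (wmean p a) n.+1| `^ k <=
    D `^ k * 2 `^ k * (x n + E * h n).
  have pH0 : 0 <= p n.+1 / psum p n.+1 * H n by exact: mulr_ge0.
  have XH0 : 0 <= `|X n| + p n.+1 / psum p n.+1 * H n by exact: addr_ge0.
  have kk : (p n.+1 / psum p n.+1) `^ k =
      p n.+1 / psum p n.+1 * (p n.+1 / psum p n.+1) `^ (k - 1).
    by rewrite mulr_powRB1// (lt_trans ltr01).
  apply: (@le_trans _ _ (n.+1%:R `^ (k - 1) * (D `^ k * (2 `^ k *
      (`|X n| `^ k + (p n.+1 / psum p n.+1 * H n) `^ k))))).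
    rewrite ler_wpM2l ?powR_ge0//.
    apply: (@le_trans _ _ ((D * (`|X n| + p n.+1 / psum p n.+1 * H n)) `^ k)).
      by rewrite ge0_ler_powR// nnegrE mulr_ge0.
    by rewrite powRM// ler_wpM2l ?powR_ge0// powRD_le.
  rewrite mulrCA [X in _ * X]mulrCA mulrA ler_wpM2l ?mulr_ge0 ?powR_ge0//.
  rewrite mulrDr lerD2l powRM// kk /h.
  rewrite [leLHS](_ : _ = (n.+1%:R * (p n.+1 / psum p n.+1)) `^ (k - 1) *
     (p n.+1 / psum p n.+1 * H n `^ k)); last first.
    by rewrite [in RHS]powRM//; ring.
  rewrite ler_wpM2r//; first by rewrite mulr_ge0 ?powR_ge0.
  by rewrite ge0_ler_powR ?nnegrE// mulr_ge0.
have hardy N : \sum_(0 <= n < N) h n <= E * \sum_(0 <= n < N) x n.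
  apply: (le_trans (weighted_hardy p0 z0 k1 N)).
  rewrite /psum big_nat_recl//= powR0 ?gt_eqF ?(lt_trans ltr01)//.
  rewrite mulr0 add0r mulr_sumr; apply: ler_sum => n _.
  rewrite -!/(psum p n.+1) powRM// ?divr_ge0// /x mulrA mulrA.
  rewrite ler_wpM2r ?powR_ge0//.
  have r0 : 0 < psum p n.+1 / p n.+1 by rewrite divr_gt0.
  rewrite -(@mulr_powRB1 _ _ k) ?(lt_trans ltr01) ?(ltW r0)// mulrA.
  rewrite (_ : p n.+1 / psum p n.+1 * _ = 1); last first.
    by field; rewrite !gt_eqF.
  rewrite mul1r -powRM//.
  by rewrite ge0_ler_powR ?nnegrE ?(ltW r0)// mulr_ge0//.
exists (D `^ k * 2 `^ k * (M + E * (E * M))) => N.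
apply: (le_trans (ler_sum _ (fun n _ => step n))).
rewrite -mulr_sumr ler_wpM2l ?mulr_ge0 ?powR_ge0//.
rewrite big_split/= -mulr_sumr; apply: lerD; first exact: hM.
rewrite ler_wpM2l//; apply: (le_trans (hardy N)).
by rewrite ler_wpM2l//; exact: hM.
Qed.

(** * Necessity *)

(** The initial value 1 keeps the maximum positive, so that its inverses and
logarithms below make sense. *)
Fixpoint runmax (R : realType) (w : nat -> R) n : R :=
  if n is m.+1 then Num.max (runmax w m) (w m) else 1.

Lemma runmax_gt0 (R : realType) (w : nat -> R) n : 0 < runmax w n.
Proof. by elim: n => //= n IH; rewrite lt_max IH. Qed.

(** If m_n is the running maximum of w, then e_n = 1/m_n - 1/m_{n+1} telescopes
to a sum at most 1. It vanishes unless w sets a new record at n, in which case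
w_n = m_{n+1} and w_n e_n = m_{n+1}/m_n - 1 >= ln m_{n+1} - ln m_n. So a bound
on sum w_n e_n bounds ln m_n. *)
Lemma abel_dini (R : realType) (w : nat -> R) (w0 : forall n, 0 <= w n) :
  (forall e, (forall n, 0 <= e n) ->
     (exists M, forall N, \sum_(0 <= n < N) e n <= M) ->
     exists M, forall N, \sum_(0 <= n < N) w n * e n <= M) ->
  exists M, forall n, w n <= M.
Proof.
move=> hw; have m0 := runmax_gt0 w.
pose e n := (runmax w n)^-1 - (runmax w n.+1)^-1.
have mono n : runmax w n <= runmax w n.+1 by rewrite /= le_max lexx.
have e0 n : 0 <= e n by rewrite subr_ge0 lef_pV2 ?posrE.
have [|M hM] := hw e e0.
  exists 1 => N; rewrite (_ : \sum_(_ <= _ < _) _ = 1 - (runmax w N)^-1).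
    by rewrite gerBl invr_ge0 ltW.
  elim: N => [|N IH]; first by rewrite big_geq//= invr1 subrr.
  by rewrite big_nat_recr//= IH /e addrA subrK.
have lnM N : ln (runmax w N) <= \sum_(0 <= n < N) w n * e n.
  elim: N => [|N IH]; first by rewrite big_geq//= ln1.
  rewrite big_nat_recr//= -lerBlDl.
  apply: le_trans (_ : ln (runmax w N.+1) - ln (runmax w N) <= _).
    by rewrite lerD2l lerN2.
  have [le_w|lt_w] := leP (w N) (runmax w N).
    by rewrite /= (max_idPl le_w) subrr mulr_ge0.
  rewrite /e /= (max_idPr (ltW lt_w)).
  have wN0 : 0 < w N := lt_trans (m0 N) lt_w.
  rewrite -ln_div ?posrE// mulrBr divff ?gt_eqF//.
  have := @le_ln1Dx _ (w N / runmax w N - 1); rewrite subrKC; apply.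
  by rewrite ltrBrDl subrr divr_gt0.
exists (expR M) => n; apply: (@le_trans _ _ (runmax w n.+1)).
  by rewrite /= le_max lexx orbT.
rewrite -(lnK (m0 n.+1)) ler_expR; exact: le_trans (lnM _) (hM _).
Qed.

(** [X n] takes the sign of the sum formed by its predecessors; [S] computes
that sum along the recursion. *)
Lemma signed_choice (R : realType) (b c : nat -> R) (c0 : forall n, 0 <= c n) :
  exists2 X : nat -> R, forall n, `|X n| = c n &
    forall n, 0 <= X n * \sum_(0 <= i < n) b i * X i.
Proof.
pose sg (s : R) : R := if 0 <= s then 1 else -1.
pose S := fix S n : R := if n is m.+1 then S m + b m * (c m * sg (S m)) else 0.
exists (fun n => c n * sg (S n)) => n.
  by rewrite normrM ger0_norm// /sg; case: ifP; rewrite ?normrN normr1 mulr1.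
have -> : \sum_(0 <= i < n) b i * (c i * sg (S i)) = S n.
  by elim: n => [|n IH]; [rewrite big_geq | rewrite big_nat_recr//= IH].
rewrite -mulrA mulr_ge0// /sg; case: ifPn; first by rewrite mul1r.
by rewrite -ltNge mulN1r oppr_ge0 => /ltW.
Qed.

(** For summable e >= 0 put c_n = (e_n / n^(k-1))^(1/k), and let X have absolute
values c and the signs of [signed_choice]. It comes from a q-summable series,
and n^(k-1) |Y_n|^k >= d_n^k e_n; hence d^k satisfies the hypothesis of
[abel_dini]. *)
Lemma wmean_diag_bounded (R : realType) (k : R) (p q : nat -> R) :
  1 < k -> (forall n, 0 < p n) -> (forall n, 0 < q n) ->
  (forall a, wmean_summable q k a -> wmean_summable p k a) ->
  exists M, forall n,
    p n.+1 / psum p n.+1 * (psum q n.+1 / q n.+1) <= M.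
Proof.
move=> hk p0 q0 sub.
have P0 := psum_gt0 p0; have Q0 := psum_gt0 q0.
have k0 : 0 < k := lt_trans ltr01 hk.
pose d n := p n.+1 / psum p n.+1 * (psum q n.+1 / q n.+1).
have d0 n : 0 <= d n by rewrite mulr_ge0 ?divr_ge0// ltW.
have root x : 0 <= x -> (x `^ k) `^ k^-1 = x.
  by move=> x0; rewrite -powRrM divff ?gt_eqF// powRr1.
have [||M hM] := @abel_dini _ (fun n => d n `^ k).
- by move=> n; exact: powR_ge0.
- move=> e e0 [B hB].
  pose c n := (e n / n.+1%:R `^ (k - 1)) `^ k^-1.
  have cE n : n.+1%:R `^ (k - 1) * c n `^ k = e n.
    rewrite /c -powRrM mulVf ?gt_eqF// powRr1 ?divr_ge0 ?powR_ge0//.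
    by rewrite mulrC divfK// gt_eqF// powR_gt0.
  have [|X Xc Xsg] := @signed_choice _
    (fun i => psum p i.+1 - p i.+1 * (psum q i.+1 / q i.+1)) c.
    by move=> n; exact: powR_ge0.
  have [a aX] := wmean_bdiff_surj X q0.
  have Yd n : d n * c n <= `|bdiff (wmean p a) n.+1|.
    rewrite (wmean_transform a p0 q0) aX -/(d n).
    under eq_bigr do rewrite aX.
    move: (Xsg n); move: (\sum_(_ <= _ < _) _) => S XS.
    have : 0 < p n.+1 / (psum p n.+1 * psum p n).
      by rewrite divr_gt0 ?mulr_gt0.
    move: (p n.+1 / _) => f f0; rewrite -Xc.
    rewrite -[d n in leLHS]ger0_norm// -normrM.
    have : 0 <= (d n * X n) * (f * S).
      by rewrite mulrACA mulr_ge0// mulr_ge0// ltW.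
    move: (d n * X n) (f * S) => u v uv.
    by rewrite -ler_sqr ?nnegrE// !real_normK ?num_real//; nra.
  have : wmean_summable p k a.
    apply: sub; apply/wmean_summableP; exists B => N.
    by under eq_bigr do rewrite aX Xc cE; exact: hB.
  move=> /wmean_summableP[M hM]; exists M => N.
  apply: le_trans (hM N); apply: ler_sum => n _.
  have c0 : 0 <= c n by exact: powR_ge0.
  rewrite -cE mulrCA -powRM// ler_wpM2l ?powR_ge0//.
  by rewrite ge0_ler_powR ?nnegrE ?(ltW k0)// mulr_ge0.
exists (M `^ k^-1) => n; rewrite -/(d n) -[leLHS]root//.
have M0 : 0 <= M := le_trans (powR_ge0 _ _) (hM n).
by rewrite ge0_ler_powR ?nnegrE ?powR_ge0// ?invr_ge0 ?(ltW k0).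
Qed.

(** * The characterization *)

Lemma psum1 (R : realType) n : psum (fun=> 1 : R) n = n.+1%:R.
Proof. by rewrite /psum big_const_nat subn0 iter_addr_0. Qed.

Theorem corollary4 (R : realType) (k : R) (p : nat -> R)
    (hk : 1 < k) (hp : forall n : nat, 0 < p n) :
  same_summable (cesaro1_summable k) (wmean_summable p k) <->
  (bigO1 (fun n => n%:R * p n / psum p n) /\
   bigO1 (fun n => psum p n / (n%:R * p n))).
Proof.
have P0 := psum_gt0 hp.
have P00 n : 0 <= psum p n by exact: ltW.
have p00 n : 0 <= p n by exact: ltW.
have one0 (n : nat) : 0 < (1 : R) by exact: ltr01.
have n0 n : 0 < n.+1%:R :> R by rewrite ltr0n.
split=> [same|[[A hA] [B hB]]].
  have [M1 hM1] := wmean_diag_bounded hk hp one0 (fun a => (same a).1).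
  have [M2 hM2] := wmean_diag_bounded hk one0 hp (fun a => (same a).2).
  split.
    exists M1 => -[//|n] _; rewrite ger0_norm; last first.
      by rewrite divr_ge0 ?mulr_ge0.
    apply: le_trans (hM1 n); rewrite psum1 divr1 mulrAC mulrC -mulrA.
    rewrite ler_wpM2l// mulrC ler_wpM2l ?invr_ge0 ?(ltW (P0 _))//.
    by rewrite ler_nat.
  exists (2 * M2) => -[//|n] _; rewrite ger0_norm; last first.
    by rewrite divr_ge0 ?mulr_ge0.
  have := hM2 n; rewrite psum1 div1r => h.
  rewrite invfM mulrA mulrAC mulrC.
  (* The Cesaro diagonal carries n + 1 where the condition has n: this costs
     the factor 2. *)
  apply: (@le_trans _ _ (2 * n.+2%:R^-1 * (psum p n.+1 / p n.+1))).
    rewrite ler_wpM2r ?divr_ge0//.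
    rewrite -[leLHS]div1r ler_pdivrMr// mulrAC ler_pdivlMr// mul1r.
    by rewrite -natrM ler_nat mul2n -addnn addSn addnS !ltnS leq_addl.
  by rewrite -mulrA ler_wpM2l.
(* The entry 2 is for the weight 1, whose P_n / p_n is n + 1 <= 2 n. *)
pose C := Num.max 2 (Num.max A B).
have cp : comparable_to_index p C.
  move=> n; split.
    rewrite -ler_pdivrMr//; apply: le_trans (ler_norm _) _.
    by apply: le_trans (hA n.+1 isT) _; rewrite !le_max lexx ?orbT.
  rewrite -ler_pdivrMr ?mulr_gt0//; apply: le_trans (ler_norm _) _.
  by apply: le_trans (hB n.+1 isT) _; rewrite !le_max lexx ?orbT.
have c1 : comparable_to_index (fun=> 1 : R) C.
  have C2 : 2 <= C by rewrite le_max lexx.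
  move=> n; rewrite psum1 mulr1; split.
    apply: (@le_trans _ _ (2 * n.+2%:R)); last by rewrite ler_wpM2r.
    by rewrite -natrM ler_nat mul2n -addnn (leq_trans (leqnSn _))// leq_addr.
  apply: (@le_trans _ _ (2 * n.+1%:R)); last by rewrite ler_wpM2r.
  by rewrite -natrM ler_nat mul2n -addnn addSn addnS !ltnS leq_addl.
by move=> a; split; apply: wmean_summable_sub.
Qed.
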